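(* Let $\mathbb{X}$ be a finite dimensional real inner product space, $\mathcal{K}\subseteq\mathbb{X}$ a nonempty closed convex cone, $b\in\mathbb{X}$, and $T\colon\mathbb{X}\to\mathbb{X}$ a positive definite linear operator. Then the equation $P_{\mathcal{K}}(x)+Tx=b$ has a unique solution $\overline{x}\in\mathbb{X}$, and for any initial point $x^0\in\mathbb{X}$ the semi-smooth Newton sequence $\{x^k\}$ generated by $$(V(x^k)+T)x^{k+1}=b,\qquad V(x^k)\in\partial_C P_{\mathcal{K}}(x^k),\qquad k\in\mathbb{N},$$ is well-defined. Additionally, if $\|T^{-1}\|<1$, then the sequence $\{x^k\}$ converges $Q$-linearly to $\overline{x}$ and satisfies $$\|x^{k+1}-\overline{x}\|\le\|T^{-1}\|\,\|x^k-\overline{x}\|,\qquad k\in\mathbb{N}.$$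
   Context: $\|x\|=\sqrt{\langle x,x\rangle}$, and for a linear operator $T$, $\|T\|=\max\{\|Tx\| : \|x\|=1\}$. A linear operator $T$ is called positive definite if it is self-adjoint and $\langle Tx,x\rangle>0$ for all $x\ne 0$. $P_{\mathcal{K}}(x)=\operatorname{argmin}\{\|y-x\| : y\in\mathcal{K}\}$ is the projection onto $\mathcal{K}$. For $F\colon\mathbb{X}\to\mathbb{X}$, with $D_F$ the set of points where $F$ is differentiable and $F'$ its Jacobian, $\partial_C F(x)=\operatorname{conv}\{\lim_{k\to\infty}F'(x_k) : x_k\to x,\ x_k\in D_F\}$ is the set of Clarke generalized Jacobians. In the iteration, $V(x^k)$ is an arbitrary chosen element of $\partial_C P_{\mathcal{K}}(x^k)$; ''well-defined'' means that at each step the linear system for $x^{k+1}$ is uniquely solvable, i.e. $V(x^k)+T$ is invertible. $\mathbb{N}$ denotes the nonnegative integers. $Q$-linear convergence to $\overline{x}$ means $x^k\to\overline{x}$ and $\|x^{k+1}-\overline{x}\|\le r\|x^k-\overline{x}\|$ for some constant $r\in[0,1)$ and all $k$. *)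

(* Defs.v *)
From HB Require Import structures.
From mathcomp Require Import all_boot all_order all_algebra.
From mathcomp Require Import all_classical all_reals all_analysis.
Import numFieldNormedType.Exports.
Import Order.TTheory GRing.Theory Num.Theory.

Set Implicit Arguments.
Unset Strict Implicit.
Unset Printing Implicit Defensive.

Local Open Scope classical_set_scope.
Local Open Scope ring_scope.

#[short(type="normedVectType")]
HB.structure Definition NormedVector (R : numFieldType) :=
  {X of NormedModule R X & Vector R X}.

Section Operators.
Context {R : realType} {X : normedVectType R}.
Implicit Types (T L V : 'End(X)) (K : set X) (F : X -> X) (x y b : X).

(* The supremum is a maximum because X is finite dimensional; it is 0 when X
   is the zero space, since [sup set0 = 0]. *)
Definition opnorm T : R := sup [set `|T x| | x in [set x | `|x| = 1]].

(* Such a T is injective, hence bijective, so that [(T^-1)%VF], in general only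
   a right inverse on the codomain of T, is the inverse of T. *)
Definition positive_definite (dot : {dot X for idfun}) T : Prop :=
  (forall x y, dot (T x) y = dot x (T y)) /\
  (forall x, x != 0 -> 0 < dot (T x) x).

Definition cone K : Prop :=
  forall (t : R) x, 0 < t -> K x -> K (t *: x).

(* The default value of [get] is not used when K is nonempty, closed and
   convex, the set of minimizers being then a singleton. *)
Definition metric_proj K x : X :=
  get [set y | K y /\ forall z, K z -> `|y - x| <= `|z - x|].

Definition convex_hull (E : lmodType R) (A : set E) : set E :=
  smallest [set B : set E | convex_set (B : set (convex_lmodType E))] A.

Definition clarke_jacobian F x : set 'End(X) :=
  convex_hull
    [set L : 'End(X) | exists u : nat -> X,
      [/\ forall k, differentiable F (u k),
          u k @[k --> \oo] --> x &
          opnorm (linfun ('d F (u k)) - L) @[k --> \oo] --> 0]].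

Definition newton_step K T b x V y : Prop :=
  clarke_jacobian (metric_proj K) x V /\ (V + T) y = b.

(* Jacobians are chosen independently at each step, hence an iterate visited
   twice may use two different ones. That there is one to choose from is not
   part of this notion: it is Rademacher's theorem. *)
Definition newton_well_defined K T b (x0 : X) : Prop :=
  forall (n : nat) (x : nat -> X) (V : nat -> 'End(X)),
    x 0%N = x0 ->
    (forall k, (k < n)%N -> newton_step K T b (x k) (V k) (x k.+1)) ->
    clarke_jacobian (metric_proj K) (x n) (V n) ->
    bijective (V n + T).

Definition newton_sequence K T b (x0 : X) (x : nat -> X) : Prop :=
  x 0%N = x0 /\
  forall k, exists V, newton_step K T b (x k) V (x k.+1).

Definition Q_linear_cvg (x : nat -> X) (xbar : X) : Prop :=
  x k @[k --> \oo] --> xbar /\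
  exists r : R, 0 <= r < 1 /\
    forall k, `|x k.+1 - xbar| <= r * `|x k - xbar|.

End Operators.

(* Main.v *)
(** Write [P] for the projection onto [K]. The reflection [2 P - id] is
   nonexpansive, and [P] is positively homogeneous. Both facts pass to the
   derivatives of [P], to their limits and to convex combinations, as
   [`|2 V h - h| <= `|h|] and [V x = P x] for every Clarke Jacobian [V] of [P]
   at [x].
   The first one gives [<V h, h> >= 0], so [V + T] is positive on nonzero
   vectors, hence bijective. The second one turns the Newton equation into
   [(V + T) (x' - xbar) = P xbar - P x - V (xbar - x)], whose right-hand side
   is half the difference of the two reflections at [xbar - x], so that its norm
   is at most [`|xbar - x|], while [<T h, h> >= `|h|^2 / ||T^-1||].
   The solution [xbar] is the fixed point of the contraction
   [x |-> x - s (P x + T x - b)] for a small [s]. *)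
From HB Require Import structures.
Require Import Defs.
From mathcomp Require Import all_boot all_order all_algebra.
From mathcomp Require Import all_classical all_reals all_analysis.
From mathcomp Require Import ring lra.
Import numFieldNormedType.Exports.
Import Order.TTheory GRing.Theory Num.Theory.

Set Implicit Arguments.
Unset Strict Implicit.
Unset Printing Implicit Defensive.

Local Open Scope classical_set_scope.
Local Open Scope ring_scope.

(** * Inner product identities, bounded linear maps and completeness *)

Section InnerProduct.
Context {R : realType} {X : normedVectType R} (dot : {dot X for idfun}).
Context (normE : forall x : X, `|x| = Num.sqrt (dot x x)).
Implicit Types (x y z : X).

Lemma dotC x y : dot x y = dot y x.
Proof. by rewrite hermC expr0 mul1r. Qed.

Lemma dotDl x y z : dot (x + y) z = dot x z + dot y z.
Proof. exact: linearDl. Qed.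
Lemma dotDr x y z : dot z (x + y) = dot z x + dot z y.
Proof. by rewrite dotC dotDl !(dotC z). Qed.
Lemma dotNl x y : dot (- x) y = - dot x y.
Proof. exact: linearNl. Qed.
Lemma dotNr x y : dot y (- x) = - dot y x.
Proof. by rewrite dotC dotNl dotC. Qed.
Lemma dotZl a x y : dot (a *: x) y = a * dot x y.
Proof. exact: linearZl_LR. Qed.
Lemma dotZr a x y : dot y (a *: x) = a * dot y x.
Proof. by rewrite dotC dotZl dotC. Qed.
Lemma dotBl x y z : dot (x - y) z = dot x z - dot y z.
Proof. by rewrite dotDl dotNl. Qed.
Lemma dotBr x y z : dot z (x - y) = dot z x - dot z y.
Proof. by rewrite dotDr dotNr. Qed.

Lemma dot0l x : dot 0 x = 0.
Proof. by rewrite -(subrr x) dotBl subrr. Qed.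

Lemma sqr_norm_dot x : `|x| ^+ 2 = dot x x.
Proof.
rewrite normE sqr_sqrtr//.
by have [->|/neq0_dnorm_gt0 /ltW//] := eqVneq x 0; rewrite dot0l.
Qed.

Lemma sqr_normD x y : `|x + y| ^+ 2 = `|x| ^+ 2 + dot x y *+ 2 + `|y| ^+ 2.
Proof. by rewrite !sqr_norm_dot dotDl !dotDr (dotC y x) mulr2n; ring. Qed.

Lemma sqr_normB x y : `|x - y| ^+ 2 = `|x| ^+ 2 - dot x y *+ 2 + `|y| ^+ 2.
Proof. by rewrite sqr_normD dotNr normrN mulNrn. Qed.

(** Cauchy-Schwarz is read off from the squared triangle inequality, which comes with the norm of
    [X]. *)
Lemma dot_le_norm x y : dot x y <= `|x| * `|y|.
Proof.
have : `|x + y| ^+ 2 <= (`|x| + `|y|) ^+ 2.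
  by rewrite ler_sqr ?nnegrE ?addr_ge0// ler_normD.
by rewrite sqr_normD; nra.
Qed.

Lemma norm_dot_le x y : `|dot x y| <= `|x| * `|y|.
Proof.
rewrite ler_norml dot_le_norm andbT lerNl -dotNr.
by rewrite (le_trans (dot_le_norm _ _))// normrN.
Qed.

(** The square of the left-hand norm is [4 |p|^2 - 4 <p, v> + |v|^2]. The reflection form passes
    easily to limits and convex combinations, the other one gives monotonicity. *)
Lemma reflection_nonexpansiveE p v :
  (`|2 *: p - v| <= `|v|) = (`|p| ^+ 2 <= dot p v).
Proof.
rewrite -ler_sqr ?nnegrE//= sqr_normB normrZ dotZl ger0_norm//.
by apply/idP/idP; rewrite -mulr_natl; nra.
Qed.

Lemma dot_suml (I : finType) (F : I -> X) y :
  dot (\sum_i F i) y = \sum_i dot (F i) y.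
Proof. exact: linear_sumlz. Qed.

Lemma dot_sumr (I : finType) (F : I -> X) y :
  dot y (\sum_i F i) = \sum_i dot y (F i).
Proof. by rewrite dotC dot_suml; apply: eq_bigr => i _; rewrite dotC. Qed.

Lemma coord_dot n (e : n.-tuple X) (i : 'I_n) :
  basis_of {:X} e -> exists w, forall x, coord e i x = dot x w.
Proof.
move=> eB; have eF := basis_free eB.
(* The coordinates of x are its inner products with the basis vectors,
   multiplied by the inverse of the Gram matrix. *)
pose G : 'M[R]_n := \matrix_(i, j) dot e`_i e`_j.
have Gu : G \in unitmx.
  rewrite -row_free_unit -kermx_eq0; apply/rowV0P => a /sub_kermxP aG.
  (* A row [a] killed by the Gram matrix gives a combination of the basis orthogonal to every [e_j],
     hence to itself. *)
  suff ae0 : \sum_i a 0 i *: e`_i = 0.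
    by apply/rowP => j; rewrite mxE -(coord_sum_free (a 0) j eF) ae0 linear0.
  apply/eqP; rewrite -normr_eq0 -sqrf_eq0 sqr_norm_dot; apply/eqP.
  rewrite dot_sumr big1// => j _.
  rewrite dotZr dot_suml.
  have := congr1 (fun m : 'rV_ _ => m 0 j) aG; rewrite !mxE => aG0.
  rewrite (eq_bigr (fun k => a 0 k * G k j)) ?aG0 ?mulr0// => k _.
  by rewrite dotZl mxE.
exists (\sum_j (invmx G) j i *: e`_j) => x.
pose a := \row_j coord e j x.
have : a *m G = \row_j dot x e`_j.
  apply/rowP => j; rewrite !mxE [in RHS](coord_basis eB (memvf x)) dot_suml.
  by apply: eq_bigr => k _; rewrite dotZl !mxE.
move=> /(congr1 (mulmx^~ (invmx G))); rewrite mulmxK//.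
move=> /rowP/(_ i); rewrite !mxE => ->.
by rewrite dot_sumr; apply: eq_bigr => k _; rewrite dotZr !mxE mulrC.
Qed.

(** In a basis, each coordinate of [x] is an inner product with a fixed vector [w i], which
    Cauchy-Schwarz bounds. *)
Lemma linear_bounded (Y : normedModType R) (f : {linear X -> Y}) :
  exists2 C, 0 <= C & forall x, `|f x| <= C * `|x|.
Proof.
have eB := vbasisP {:X}; set e := vbasis _ in eB.
have /choice[w wE] i : exists w, forall x, coord e i x = dot x w.
  exact: coord_dot.
exists (\sum_i `|w i| * `|f e`_i|).
  by apply: sumr_ge0 => i _; exact: mulr_ge0.
move=> x; rewrite {1}(coord_basis eB (memvf x)) linear_sum mulr_suml.
rewrite (le_trans (ler_norm_sum _ _ _))// ler_sum// => i _.
rewrite linearZ normrZ/= mulrAC ler_wpM2r// mulrC wE; exact: norm_dot_le.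
Qed.

(** Completeness comes from that of [R], coordinate by coordinate: bounded coordinate forms send
    Cauchy filters to Cauchy filters. *)
Lemma cauchy_cvg_dot (F : set_system X) : ProperFilter F -> cauchy F -> cvg F.
Proof.
move=> FF Fc.
have eB := vbasisP {:X}; set e := vbasis _ in eB.
have coord_cvg i : cvg (coord e i @ F).
  apply: cauchy_cvg.
  have [C C0 Cf] := linear_bounded (coord e i : {linear X -> R^o}).
  apply/cauchyP => eps eps0.
  have C1 : 0 < C + 1 by rewrite ltr_wpDl.
  have /cauchyP/(_ (eps / (C + 1)))[|x xF] := Fc; first by rewrite divr_gt0.
  exists (coord e i x).
  suff : F (coord e i @^-1` ball (coord e i x) eps) by [].
  apply: filterS xF => y /=.
  rewrite -!ball_normE/= => xy.
  rewrite -[coord e i x - _](linearB (coord e i)).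
  rewrite (le_lt_trans (Cf _))// (le_lt_trans (y := (C + 1) * `|x - y|))//.
    by rewrite ler_wpM2r// lerDl.
  by rewrite mulrC -ltr_pdivlMr.
have : (fun x => \sum_i coord e i x *: e`_i) @ F -->
    \sum_i lim (coord e i @ F) *: e`_i.
  have addc : continuous (fun z : X * X => z.1 + z.2) by exact: add_continuous.
  apply: (@cvg_big X _ +%R 0 xpredT addc X F _
    (fun i x => coord e i x *: e`_i)) => i _.
  by apply: cvgZr_tmp; exact: coord_cvg.
under eq_fun do rewrite -(coord_basis eB (memvf _)).
by move=> Fl; apply/cvg_ex; eexists; exact: Fl.
Qed.

End InnerProduct.

(** * Projection onto a closed convex set *)

Lemma convex_setP (R : realType) (E : lmodType R) (A : set E) :
  convex_set (A : set (convex_lmodType E)) <->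
  forall (t : R) x y, 0 <= t <= 1 -> A x -> A y -> A (t *: x + (1 - t) *: y).
Proof.
split=> [cA t x y /andP[t0 t1] Ax Ay | cA x y t /set_mem Ax /set_mem Ay].
  by apply: set_mem; apply: (cA x y (Itv01 t0 t1)); exact: mem_set.
by apply: mem_set; apply: cA => //; rewrite ge0 le1.
Qed.

Section Projection.
Context {R : realType} {X : normedVectType R} (dot : {dot X for idfun}).
Context (normE : forall x : X, `|x| = Num.sqrt (dot x x)).
Context {K : set X} (K_neq0 : K !=set0) (K_closed : closed K).
Context (K_convex : convex_set (K : set (convex_lmodType X))).
Implicit Types (x y z : X).

(** The parallelogram law for [x - z] and [y - z]; it yields both existence and uniqueness of the
    nearest point. *)
Lemma sqr_norm_midpoint x y z :
  `|x - y| ^+ 2 + 4 * `|2^-1 *: (x + y) - z| ^+ 2 =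
  2 * `|x - z| ^+ 2 + 2 * `|y - z| ^+ 2.
Proof.
have -> : x - y = (x - z) - (y - z) by rewrite opprB addrA subrK.
have -> : 2^-1 *: (x + y) - z = 2^-1 *: ((x - z) + (y - z)).
  rewrite addrACA -opprD scalerBr; congr (_ - _).
  by rewrite -mulr2n -(scaler_nat 2 z) scalerA mulVf ?scale1r ?pnatr_eq0.
rewrite normrZ exprMn; move: (x - z) (y - z) => p q.
rewrite (sqr_normB normE) (sqr_normD normE) ger0_norm ?invr_ge0//.
by field.
Qed.

Lemma convex_set_midpoint x y : K x -> K y -> K (2^-1 *: (x + y)).
Proof.
move=> Kx Ky; have /convex_setP/(_ 2^-1 x y) := K_convex.
have -> : 1 - 2^-1 = 2^-1 :> R by field.
have h : 0 <= (2^-1 : R) <= 1 by apply/andP; split; lra.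
by rewrite -scalerDr; apply.
Qed.

(** A minimizing sequence is Cauchy, because midpoints stay in [K] and cannot beat the infimum; its
    limit is a minimizer. *)
Lemma metric_projP x : K (metric_proj K x) /\
  forall z, K z -> `|metric_proj K x - x| <= `|z - x|.
Proof.
suff [y Ky] : exists y,
    [set y | K y /\ forall z, K z -> `|y - x| <= `|z - x|] y.
  exact: (getPex (ex_intro _ y Ky)).
pose E : set R := [set `|z - x| ^+ 2 | z in K].
have Einf : has_inf E.
  split; first by have [z Kz] := K_neq0; exists (`|z - x| ^+ 2), z.
  by exists 0 => _ [z _ <-]; exact: sqr_ge0.
have infE z : K z -> inf E <= `|z - x| ^+ 2.
  by move=> Kz; apply: inf_lbound; [case: Einf|exists z].
have /choice[u uP] n : exists z, K z /\ `|z - x| ^+ 2 < inf E + n.+1%:R^-1.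
  have n0 : (0 : R) < n.+1%:R^-1 by rewrite invr_gt0.
  by have [_ [z Kz <-]] := inf_adherent n0 Einf; exists z.
have u_cauchy : cauchy (u @ \oo).
  apply: cauchy_exP => e e0.
  (* For [n >= N] the parallelogram law bounds [|u N - u n|^2] by [2 / (N + 1) + 2 / (n + 1)], the
     infimum cancelling out. *)
  have [N Ne] : exists N, 4 * N.+1%:R^-1 < e ^+ 2.
    have e4 : 0 < 4^-1 * e ^+ 2 by rewrite mulr_gt0 ?exprn_gt0.
    have [N _ /(_ N (leqnn N)) Ne] := near_infty_natSinv_lt (PosNum e4).
    by exists N; rewrite -ltr_pdivlMl.
  exists (u N); exists N => // n /= Nn.
  rewrite -ball_normE/=.
  rewrite -ltr_sqr ?nnegrE// ?ltW//.
  have [[Kn un] [KN uN]] := (uP n, uP N).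
  have := infE (2^-1 *: (u N + u n)).
  move=> /(_ (convex_set_midpoint KN Kn)).
  have := sqr_norm_midpoint (u N) (u n) x.
  have : n.+1%:R^-1 <= N.+1%:R^-1 :> R by rewrite lef_pV2 ?posrE// ler_nat ltnS.
  move: Ne un uN; move: (n.+1%:R^-1 : R) (N.+1%:R^-1 : R) (inf E) => a b d.
  lra.
have /cvg_ex[/= l ul] : cvg (u @ \oo) by exact: (cauchy_cvg_dot normE).
exists l; split.
  by apply: (closed_cvg _ K_closed _ _ ul); apply: nearW => n; case: (uP n).
move=> z Kz; rewrite -ler_sqr ?nnegrE//; apply: le_trans (infE _ Kz).
have u2 : `|u n - x| ^+ 2 @[n --> \oo] --> `|l - x| ^+ 2.
  by rewrite expr2; under eq_cvg do rewrite expr2;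
     apply: cvgM; apply: cvg_norm; apply: cvgB => //; exact: cvg_cst.
have h : inf E + n.+1%:R^-1 @[n --> \oo] --> inf E.
  rewrite -[X in _ --> X]addr0; apply: cvgD; first exact: cvg_cst.
  exact: cvg_harmonic.
by apply: ler_cvg_to u2 h _; apply: nearW => n; apply/ltW; case: (uP n).
Qed.

(** Moving from the projection [p] towards [z] stays in [K], so it cannot decrease the distance to
    [x]. *)
Lemma metric_proj_var x z : K z ->
  dot (x - metric_proj K x) (z - metric_proj K x) <= 0.
Proof.
move=> Kz; have [] := metric_projP x; set p := metric_proj K x => Kp pmin.
set a := dot _ _; rewrite leNgt; apply/negP => a0.
pose b := `|z - p| ^+ 2.
have main (t : R) : 0 <= t <= 1 -> t * a * 2 <= t ^+ 2 * b.
  move=> t01; have /convex_setP/(_ t z p t01 Kz Kp)/pmin := K_convex.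
  rewrite -ler_sqr ?nnegrE//.
  have -> : t *: z + (1 - t) *: p - x = t *: (z - p) - (x - p).
    rewrite scalerBl scale1r scalerBr opprB !addrA.
    by congr (_ - _); rewrite addrAC.
  rewrite [leRHS](sqr_normB normE) normrZ exprMn real_normK ?num_real// -/b.
  by rewrite dotZl dotC -/a (distrC x); lra.
have b0 : 0 <= b by exact: sqr_ge0.
have ab : 0 < a + b by lra.
(* This explicit [t] replaces the limit at 0: [main] becomes [2 (a + b) <= b], which is absurd since
   [a > 0] and [b >= 0]. *)
have := main (a / (a + b)).
have -> : 0 <= a / (a + b) <= 1.
  by rewrite divr_ge0 ?(ltW a0) ?(ltW ab)//= ler_pdivrMr// mul1r lerDl.
move=> /(_ isT).
have -> : a / (a + b) * a * 2 = (a / (a + b)) ^+ 2 * (2 * (a + b)).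
  by field; lra.
have : 0 < (a / (a + b)) ^+ 2 by rewrite exprn_gt0// divr_gt0.
by move=> t0; rewrite ler_pM2l//; lra.
Qed.

(** Sum of the variational inequalities at [x] and at [y], each tested at the other projection. *)
Lemma metric_proj_firm x y :
  `|metric_proj K x - metric_proj K y| ^+ 2 <=
  dot (metric_proj K x - metric_proj K y) (x - y).
Proof.
have [Kx _] := metric_projP x; have [Ky _] := metric_projP y.
have := metric_proj_var x Ky; have := metric_proj_var y Kx.
rewrite (sqr_norm_dot normE).
set p := metric_proj K x; set q := metric_proj K y.
rewrite !(dotBl, dotBr) !(dotC dot y) !(dotC dot x)
  (dotC dot q p); lra.
Qed.

Lemma metric_proj_uniq x y :
  K y -> (forall z, K z -> `|y - x| <= `|z - x|) -> metric_proj K x = y.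
Proof.
move=> Ky ymin; have [Kp pmin] := metric_projP x; move: Kp pmin.
set p := metric_proj K x => Kp pmin.
have := pmin _ (convex_set_midpoint Kp Ky).
rewrite -ler_sqr ?nnegrE// => pm.
have := ymin _ Kp; rewrite -ler_sqr ?nnegrE// => yp.
have := sqr_norm_midpoint p y x => mid.
apply/eqP; rewrite -subr_eq0 -normr_eq0 -sqrf_eq0 eq_le sqr_ge0 andbT; lra.
Qed.

(** Scaling by [t] maps [K] onto itself and multiplies all distances by [t], so it preserves
    minimizers. *)
Lemma metric_proj_homog (K_cone : cone K) (t : R) x : 0 < t ->
  metric_proj K (t *: x) = t *: metric_proj K x.
Proof.
move=> t0; have [Kp pmin] := metric_projP x.
apply: metric_proj_uniq; first exact: K_cone.
move=> z Kz; rewrite -scalerBr normrZ gtr0_norm//.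
have -> : z - t *: x = t *: (t^-1 *: z - x).
  by rewrite scalerBr scalerA divff ?gt_eqF// scale1r.
rewrite normrZ gtr0_norm// ler_pM2l//; apply: pmin.
by apply: K_cone => //; rewrite invr_gt0.
Qed.

Lemma metric_proj_reflection x y :
  `|2 *: (metric_proj K x - metric_proj K y) - (x - y)| <= `|x - y|.
Proof. rewrite (reflection_nonexpansiveE normE); exact: metric_proj_firm. Qed.

End Projection.

(** * Operator norm and Clarke Jacobians *)

Lemma opnorm_ge0 (R : realType) (X : normedVectType R) (T : 'End(X)) :
  0 <= opnorm T.
Proof.
rewrite /opnorm; set E := [set _ | _ in _].
(* Without a supremum, as when [X] is the zero space, [sup] takes its default value 0. *)
have [supE|supE] := pselect (has_sup E); last by rewrite sup_out.
have [[r [x x1 Txr]] _] := supE.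
apply: (@le_trans _ _ r); first by rewrite -Txr.
by apply: sup_upper_bound => //; exists x.
Qed.

Section Operators.
Context {R : realType} {X : normedVectType R} (dot : {dot X for idfun}).
Context (normE : forall x : X, `|x| = Num.sqrt (dot x x)).
Implicit Types (x y z : X) (T V : 'End(X)).

Lemma linear_continuous_dot (Y : normedModType R) (f : {linear X -> Y}) :
  continuous f.
Proof.
have [C _ Cf] := linear_bounded normE f.
apply: bounded_linear_continuous; apply/linear_boundedP.
near=> r => x; rewrite (le_trans (Cf x))// ler_wpM2r//.
Unshelve. all: by end_near. Qed.

Lemma opnormP T x : `|T x| <= opnorm T * `|x|.
Proof.
have [->|x0] := eqVneq x 0; first by rewrite linear0 !normr0 mulr0.
have nx0 : 0 < `|x| by rewrite normr_gt0.
have [C _ CT] := linear_bounded normE T.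
rewrite -ler_pdivrMr// mulrC -[X in X * _]ger0_norm ?invr_ge0//.
rewrite -normrZ -linearZ; apply: ub_le_sup.
  by exists C => _ [y y1 <-]; rewrite (le_trans (CT y))// y1 mulr1.
exists (`|x|^-1 *: x) => //=.
by rewrite normrZ ger0_norm ?invr_ge0// mulVf ?gt_eqF.
Qed.

Section Clarke.
Context (F : X -> X).
Context (F_refl : forall x y, `|2 *: (F x - F y) - (x - y)| <= `|x - y|).

(** [F] is the average of the identity and its reflection, both nonexpansive. *)
Lemma reflection_nonexpansive x y : `|F x - F y| <= `|x - y|.
Proof.
have : `|2 *: (F x - F y)| <= `|x - y| + `|x - y|.
  rewrite -[2 *: _](subrK (x - y)).
  by rewrite (le_trans (ler_normD _ _))// lerD2r.
by rewrite normrZ ger0_norm//; lra.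
Qed.

Lemma reflection_continuous : continuous F.
Proof.
move=> x; apply/cvgrPdist_le => e e0.
near=> y; rewrite (le_trans (reflection_nonexpansive _ _))//.
Unshelve. all: by end_near. Qed.

Lemma cvg_reflection (I : Type) (G : set_system I) {GG : ProperFilter G}
    (q : I -> X) p v : q @ G --> p ->
  (\forall i \near G, `|2 *: q i - v| <= `|v|) -> `|2 *: p - v| <= `|v|.
Proof.
move=> qp; apply: cvgr_to_le; apply: cvg_norm.
by apply: cvgB; [exact: cvgZl_tmp|exact: cvg_cst].
Qed.

Lemma diff_cvg u v : differentiable F u ->
  h^-1 *: (F (h *: v + u) - F u) @[h --> 0^'] --> 'd F u v.
Proof. by move=> Fu; rewrite -deriveE//; exact: diff_derivable. Qed.

(** The bound holds for each difference quotient, by [F_refl] divided by [|h|], and is closed under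
    limits. *)
Lemma diff_reflection u v : differentiable F u ->
  `|2 *: 'd F u v - v| <= `|v|.
Proof.
move=> /diff_cvg -/(_ v) Fuv; apply: cvg_reflection Fuv _; near=> h.
have h0 : h != 0 by near: h; exact: nbhs_dnbhs_neq.
have := F_refl (h *: v + u) u; rewrite addrK.
have -> : 2 *: (F (h *: v + u) - F u) - h *: v =
    h *: (2 *: (h^-1 *: (F (h *: v + u) - F u)) - v).
  by rewrite [in RHS]scalerBr !scalerA (mulrC h) -mulrA mulVf ?mulr1.
by rewrite !normrZ ler_pM2l// normr_gt0.
Unshelve. all: by end_near. Qed.

Context (F_homog : forall t x, 0 < t -> F (t *: x) = t *: F x).

(** Euler's identity: along [u] itself the difference quotient is constantly [F u] once [|h| < 1],
    where [h + 1] is positive. *)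
Lemma diff_homog u : differentiable F u -> 'd F u u = F u.
Proof.
move=> /diff_cvg -/(_ u) Fuu.
apply: (cvg_unique _ Fuu) => //.
have cF : cst (F u) @ (0 : R)^' --> F u by exact: cvg_cst.
apply: cvg_trans cF.
apply: near_eq_cvg; near=> h.
have h0 : h != 0 by near: h; exact: nbhs_dnbhs_neq.
have h1 : 0 < h + 1.
  have : `|h| < 1 by near: h; exact: dnbhs0_lt.
  by rewrite ltr_norml; lra.
have -> : h *: u + u = (h + 1) *: u by rewrite scalerDl scale1r.
by rewrite F_homog// scalerDl scale1r addrK scalerA mulVf ?scale1r.
Unshelve. all: by end_near. Qed.

(** By minimality of the convex hull, it suffices that the operators with both properties form a
    convex set containing the limits of derivatives. *)
Lemma clarke_jacobian_homog x V : clarke_jacobian F x V ->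
  (forall h, `|2 *: V h - h| <= `|h|) /\ V x = F x.
Proof.
move=> /(_ [set V | (forall h, `|2 *: V h - h| <= `|h|) /\ V x = F x]).
apply; split=> [|{}V [u [Fu ux DV]]].
  apply/convex_setP => t V1 V2 /andP[t0 t1] [V1h V1x] [V2h V2x]; split=> [h|].
    rewrite !lfunE/= !lfunE/=.
    have -> : 2 *: (t *: V1 h + (1 - t) *: V2 h) - h =
        t *: (2 *: V1 h - h) + (1 - t) *: (2 *: V2 h - h).
      rewrite [in RHS]scalerBr [in RHS]scalerBr addrACA -opprD -scalerDl.
      by rewrite (addrC t) subrK scale1r scalerDr !scalerA !(mulrC 2).
    rewrite (le_trans (ler_normD _ _))// !normrZ !ger0_norm ?subr_ge0//.
    have -> : `|h| = t * `|h| + (1 - t) * `|h| by ring.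
    by rewrite lerD// ler_wpM2l// subr_ge0.
  by rewrite !lfunE/= !lfunE/= V1x V2x -scalerDl (addrC t) subrK scale1r.
have DVle k h :
    `|'d F (u k) h - V h| <= opnorm (linfun ('d F (u k)) - V) * `|h|.
  by have := opnormP (linfun ('d F (u k)) - V) h; rewrite !lfunE/= !lfunE.
split=> [h|].
  have Dh : 'd F (u k) h @[k --> \oo] --> V h.
    apply/subr_cvg0; apply: norm_cvg0.
    apply: (squeeze_cvgr (f := cst 0)
      (h := fun k => opnorm (linfun ('d F (u k)) - V) * `|h|)).
    - by apply: nearW => k; rewrite normr_ge0 DVle.
    - exact: cvg_cst.
    - by rewrite -[X in _ --> X](mul0r `|h|); apply: cvgM => //; exact: cvg_cst.
  by apply: cvg_reflection Dh _; apply: nearW => k; exact: diff_reflection.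
have Vu : V (u k) @[k --> \oo] --> V x.
  by apply: continuous_cvg => //; exact: linear_continuous_dot.
have Fux : F (u k) @[k --> \oo] --> F x.
  by apply: continuous_cvg => //; exact: reflection_continuous.
(* By Euler's identity this is ['d F (u k) - V] applied to [u k]: the operator tends to 0 while
   [|u k|] tends to [|x|]. *)
have FV0 : F (u k) - V (u k) @[k --> \oo] --> 0.
  apply: norm_cvg0.
  apply: (squeeze_cvgr (f := cst 0)
      (h := fun k => opnorm (linfun ('d F (u k)) - V) * `|u k|)).
  - by apply: nearW => k; rewrite normr_ge0 -[F _]diff_homog// DVle.
  - exact: cvg_cst.
  - by rewrite -[X in _ --> X](mul0r `|x|); apply: cvgM => //; exact: cvg_norm.
apply/esym/eqP; rewrite -subr_eq0; apply/eqP.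
exact: (cvg_unique _ (cvgB Fux Vu) FV0).
Qed.

End Clarke.
End Operators.

(** * Solvability of the equation and the Newton step *)

Section Newton.
Context {R : realType} {X : normedVectType R} (dot : {dot X for idfun}).
Context (normE : forall x : X, `|x| = Num.sqrt (dot x x)).
Implicit Types (x y z : X) (T V : 'End(X)).

Lemma contraction_fixed_point (g : X -> X) (q : R) : 0 <= q < 1 ->
  (forall x y, `|g x - g y| <= q * `|x - y|) -> exists x, g x = x.
Proof.
move=> /andP[q0 q1] gq.
(* Banach's theorem wants a complete space, so [X] is repackaged with the completeness proved
   above. *)
pose XC : completeNormedModType R :=
  HB.pack (NormedVector.sort X) (NormedVector.class X)
      (Uniform_isComplete.Build X (cauchy_cvg_dot normE)).
have gT : {homo (g : XC -> XC) : x / [set: XC] x >-> [set: XC] x} by [].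
have ctr : is_contraction (mkfun gT).
  by exists (NngNum q0); split => //= -[x y] _ /=; exact: gq.
have [||x _ xg] := banach_fixed_point ctr; first exact: closedT.
- by exists (0 : X).
- by exists x.
Qed.

Lemma positive_definite_ge0 T x : positive_definite dot T -> 0 <= dot (T x) x.
Proof.
move=> [_ T0]; have [->|/T0/ltW//] := eqVneq x 0.
by rewrite (linear0 T) dot0l.
Qed.

(** Stated for positivity alone, so that it serves [V + T] as well as [T]. *)
Lemma coercive_lker0 T : (forall x, x != 0 -> 0 < dot (T x) x) ->
  lker T == 0%VS.
Proof.
move=> T0; apply/lker0P => x y Txy; apply/eqP; rewrite -subr_eq0.
apply/negPn/negP => /T0; rewrite (linearB T) /= Txy subrr.
by rewrite dot0l ltxx.
Qed.

(* Positivity of T at [C *: h - T^-1 h] replaces an eigenvalue estimate. *)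
Lemma positive_definite_coercive T (C : R) h : positive_definite dot T ->
  0 <= C -> (forall x, `|(T^-1)%VF x| <= C * `|x|) ->
  `|h| ^+ 2 <= C * dot (T h) h.
Proof.
move=> Tpd C0 TC; have [Tsym T0] := Tpd.
have TK := lker0_lfunVK (coercive_lker0 T0).
have := TC h; have := TK h; set u := (T^-1)%VF h => Tu uC.
have [C_eq0|C_neq0] := eqVneq C 0.
  move: uC; rewrite C_eq0 mul0r normr_le0 => /eqP u0.
  by rewrite -Tu u0 linear0 normr0 expr2 !mul0r.
have {}C0 : 0 < C by rewrite lt_neqAle eq_sym C_neq0.
(* Expanded, this is [C^2 <T h, h> - 2 C |h|^2 + <h, u> >= 0], where [<h, u> <= C |h|^2]; dividing
   by [C] concludes. *)
have := positive_definite_ge0 (C *: h - u) Tpd.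
rewrite (linearB T) linearZ/= Tu dotBl !dotBr !dotZl !dotZr (Tsym h u) Tu.
rewrite -(sqr_norm_dot normE).
have := dot_le_norm normE h u.
have : `|h| * `|u| <= C * `|h| ^+ 2 by rewrite expr2 mulrCA ler_wpM2l.
move: (dot h u) (dot (T h) h) (`|h| ^+ 2) (`|h| * `|u|) => a c d e ed ae ge0.
rewrite -(ler_pM2l C0); lra.
Qed.

Context {K : set X} (K_neq0 : K !=set0) (K_closed : closed K).
Context (K_convex : convex_set (K : set (convex_lmodType X))).

Lemma proj_equation_solvable T b : positive_definite dot T ->
  exists x, metric_proj K x + T x = b.
Proof.
move=> Tpd.
pose P := metric_proj K.
have [C1 C10 TC1] := linear_bounded normE (T^-1)%VF.
have [C2 C20 TC2] := linear_bounded normE T.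
(* One constant for three uses: it is a Lipschitz constant of [P + T], a bound for the inverse of
   [T], and at least 1. *)
pose C := 1 + C1 + C2.
have C_ge1 : 1 <= C by rewrite /C; lra.
have C_gt0 : 0 < C by lra.
pose D x y := P x + T x - (P y + T y).
have DE x y : D x y = P x - P y + T (x - y).
  by rewrite /D linearB/= opprD addrACA.
have Dle x y : `|D x y| <= C * `|x - y|.
  rewrite DE (le_trans (ler_normD _ _))//.
  have := reflection_nonexpansive
    (metric_proj_reflection normE K_neq0 K_closed K_convex) x y.
  have := TC2 (x - y); have : 0 <= C1 * `|x - y| by exact: mulr_ge0.
  rewrite /C !mulrDl mul1r -/P; lra.
have Dge x y : `|x - y| ^+ 2 <= C * dot (D x y) (x - y).
  rewrite DE dotDl mulrDr.
  have /(_ C (x - y)) := positive_definite_coercive _ Tpd.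
  have Pxy : 0 <= C * dot (P x - P y) (x - y).
    apply: mulr_ge0; first exact: ltW.
    apply: le_trans (sqr_ge0 _) (metric_proj_firm normE _ _ _ x y) => //.
  have TC z : `|(T^-1)%VF z| <= C * `|z|.
    rewrite (le_trans (TC1 z))// ler_wpM2r// /C; lra.
  by move=> /(_ (ltW C_gt0) TC); lra.
(* [|x - y - s D|^2 <= (1 - 2 s / C + s^2 C^2) |x - y|^2], which is smallest
   for [s = C^-3], where the factor is [1 - C^-4 <= q^2]. *)
pose s := C^-1 ^+ 3; pose q := 1 - C^-1 ^+ 4 / 2.
have Ci_gt0 : 0 < C^-1 by rewrite invr_gt0.
have Ci4 : C^-1 ^+ 4 <= 1 by rewrite exprn_ile1 ?invf_le1// ltW.
have Ci4_gt0 : 0 < C^-1 ^+ 4 by rewrite exprn_gt0.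
have q01 : 0 <= q < 1 by rewrite /q; apply/andP; split; lra.
have [|x xfix] := @contraction_fixed_point
    (fun x => x - s *: (P x + T x - b)) q q01.
  move=> x y.
  have -> : x - s *: (P x + T x - b) - (y - s *: (P y + T y - b)) =
      (x - y) - s *: D x y.
    by rewrite opprD addrACA -opprD -scalerBr opprB addrA subrK.
  have /andP[q0 _] := q01.
  rewrite -ler_sqr ?nnegrE ?mulr_ge0//.
  rewrite (sqr_normB normE) exprMn normrZ exprMn dotZr dotC.
  rewrite ger0_norm ?exprn_ge0 ?(ltW Ci_gt0)//.
  have D1 := Dge x y.
  have D2 : `|D x y| ^+ 2 <= C ^+ 2 * `|x - y| ^+ 2.
    by rewrite -exprMn ler_sqr ?nnegrE ?mulr_ge0// ltW.
  have E1 : C^-1 ^+ 4 * `|x - y| ^+ 2 <= s * dot (D x y) (x - y).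
    have -> : s * dot (D x y) (x - y) = C^-1 ^+ 4 * (C * dot (D x y) (x - y)).
      by rewrite /s; field; rewrite gt_eqF.
    by rewrite ler_pM2l.
  have E2 : s ^+ 2 * `|D x y| ^+ 2 <= C^-1 ^+ 4 * `|x - y| ^+ 2.
    have -> : C^-1 ^+ 4 * `|x - y| ^+ 2 = s ^+ 2 * (C ^+ 2 * `|x - y| ^+ 2).
      by rewrite /s; field; rewrite gt_eqF.
    by rewrite ler_pM2l// exprn_gt0// exprn_gt0.
  (* The surplus of [q^2] over [1 - C^-4]; this choice of [q] avoids a square root. *)
  have E3 : 0 <= (C^-1 ^+ 4 / 2) ^+ 2 * `|x - y| ^+ 2.
    by rewrite mulr_ge0// sqr_ge0.
  have -> : q ^+ 2 * `|x - y| ^+ 2 = `|x - y| ^+ 2 - C^-1 ^+ 4 * `|x - y| ^+ 2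
     + (C^-1 ^+ 4 / 2) ^+ 2 * `|x - y| ^+ 2.
    by rewrite /q; field; rewrite gt_eqF.
  by move: E1 E2 E3; lra.
exists x; apply/eqP; rewrite -subr_eq0.
have : s *: (P x + T x - b) == 0.
  by rewrite -(subKr x (s *: _)) xfix subrr.
by rewrite scaler_eq0 expf_eq0/= gt_eqF.
Qed.

(** [P] is monotone, so pairing the difference of the equations with [x - y] would give
    [<T (x - y), x - y> <= 0]. *)
Lemma proj_equation_unique T x y : positive_definite dot T ->
  metric_proj K x + T x = metric_proj K y + T y -> x = y.
Proof.
move=> [_ T0] /eqP; rewrite -subr_eq0 opprD addrACA => /eqP xy.
apply/eqP; rewrite -subr_eq0; apply/negPn/negP => /T0.
move/(congr1 (dot^~ (x - y))): xy; rewrite /= -(linearB T) dotDl dot0l.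
have := metric_proj_firm normE K_neq0 K_closed K_convex x y.
have := sqr_ge0 `|metric_proj K x - metric_proj K y|; lra.
Qed.

Context (K_cone : cone K) {T : 'End(X)} (Tpd : positive_definite dot T).

Let clarkeP x V : clarke_jacobian (metric_proj K) x V ->
  (forall h, `|2 *: V h - h| <= `|h|) /\ V x = metric_proj K x.
Proof.
apply: clarke_jacobian_homog => [||t y t0]; first exact: normE.
- exact: (metric_proj_reflection normE).
- exact: (metric_proj_homog normE).
Qed.

Lemma clarke_proj_ge0 x V h : clarke_jacobian (metric_proj K) x V ->
  0 <= dot (V h) h.
Proof.
move=> /clarkeP[/(_ h) + _]; rewrite (reflection_nonexpansiveE normE).
exact/le_trans/sqr_ge0.
Qed.

Lemma newton_bijective x V : clarke_jacobian (metric_proj K) x V ->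
  bijective (V + T).
Proof.
move=> VK; have VT0 : lker (V + T) == 0%VS.
  apply: coercive_lker0 => h h0; rewrite lfunE/= dotDl ltr_wpDl//.
    exact: clarke_proj_ge0 VK.
  by case: Tpd => _; exact.
exists ((V + T)^-1)%VF; [exact: lker0_lfunK|exact: lker0_lfunVK].
Qed.

Lemma newton_step_le b x y xbar V : metric_proj K xbar + T xbar = b ->
  newton_step K T b x V y -> `|y - xbar| <= opnorm (T^-1)%VF * `|x - xbar|.
Proof.
move=> xbarE [VK yE]; have [Vr Vx] := clarkeP VK.
pose d := xbar - x; pose h := y - xbar.
pose w := metric_proj K xbar - metric_proj K x - V d.
have wE : (V + T) h = w.
  rewrite /h /w linearB/= yE -xbarE lfunE/= /d linearB/= Vx.
  by rewrite opprB opprD addrACA subrr addr0 addrA subrK.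
have wd : `|w| <= `|d|.
  have := metric_proj_reflection normE K_neq0 K_closed K_convex xbar x.
  have := Vr d; rewrite -/d => Vd pd.
  (* The terms [d] cancel between the two reflections. Bounding the two parts of [w] separately
     would only give [2 |d|]. *)
  have : `|2 *: w| <= `|d| + `|d|.
    have -> : 2 *: w =
        (2 *: (metric_proj K xbar - metric_proj K x) - d) - (2 *: V d - d).
      rewrite /w; move: (metric_proj K xbar - _) (V d) (d) => p v e.
      by rewrite scalerBr opprB addrA subrK.
    by rewrite (le_trans (ler_normB _ _))// lerD.
  by rewrite normrZ ger0_norm//; lra.
have c0 := opnorm_ge0 (T^-1)%VF; set c := opnorm _ in c0 *.
have hT : `|h| ^+ 2 <= c * dot (T h) h.
  by apply: positive_definite_coercive => // z; exact: opnormP.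
(* Adding [<V h, h> >= 0] turns [<T h, h>] into [<w, h>]; a factor [|h|] is cancelled afterwards. *)
have hw : `|h| ^+ 2 <= c * (`|w| * `|h|).
  apply: le_trans hT _; rewrite ler_wpM2l//.
  apply: le_trans (dot_le_norm normE _ _).
  by rewrite -wE lfunE/= dotDl lerDr (clarke_proj_ge0 _ VK).
rewrite -/h (distrC x) -/d.
have [->|h0] := eqVneq h 0; first by rewrite normr0 mulr_ge0.
have {}h0 : 0 < `|h| by rewrite normr_gt0.
rewrite -(ler_pM2r h0) -expr2 (le_trans hw)// -mulrA ler_wpM2l//.
by rewrite ler_wpM2r.
Qed.

End Newton.

(** * Q-linear convergence and the conclusion *)

Lemma geometric_Q_linear_cvg (R : realType) (X : normedVectType R)
    (x : nat -> X) (xbar : X) (r : R) : 0 <= r < 1 ->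
  (forall k, `|x k.+1 - xbar| <= r * `|x k - xbar|) -> Q_linear_cvg x xbar.
Proof.
move=> /andP[r0 r1] xr; split; last by exists r; rewrite r0 r1.
have xk k : `|x k - xbar| <= geometric `|x 0%N - xbar| r k.
  rewrite /geometric/=; elim: k => [|k IH]; first by rewrite expr0 mulr1.
  by rewrite (le_trans (xr k))// exprS mulrCA ler_wpM2l.
apply/subr_cvg0; apply: norm_cvg0.
apply: (squeeze_cvgr (f := cst 0) (h := geometric `|x 0%N - xbar| r)).
- by apply: nearW => k; rewrite normr_ge0 xk.
- exact: cvg_cst.
- by apply: cvg_geometric; rewrite ger0_norm.
Qed.

Theorem theorem3p3 (R : realType) (X : normedVectType R)
    (dot : {dot X for idfun})
    (normE : forall x : X, `|x| = Num.sqrt (dot x x))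
    (K : set X) (K_neq0 : K !=set0) (K_closed : closed K)
    (K_convex : convex_set (K : set (convex_lmodType X))) (K_cone : cone K)
    (b : X) (T : 'End(X)) (T_pd : positive_definite dot T) :
  exists xbar : X,
    [/\ metric_proj K xbar + T xbar = b,
        forall y : X, metric_proj K y + T y = b -> y = xbar &
        forall x0 : X,
          newton_well_defined K T b x0 /\
          (opnorm (T^-1)%VF < 1 ->
           forall x : nat -> X, newton_sequence K T b x0 x ->
             Q_linear_cvg x xbar /\
             forall k : nat,
               `|x k.+1 - xbar| <= opnorm (T^-1)%VF * `|x k - xbar|)].
Proof.
have [xbar xbarE] :=
  proj_equation_solvable normE K_neq0 K_closed K_convex b T_pd.
exists xbar; split=> // [y yE|x0].
  apply: (proj_equation_unique normE K_neq0 K_closed K_convex T_pd).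
  by rewrite yE.
split=> [n x V _ _ VK|T1 x [_ xN]].
  exact: (newton_bijective normE K_neq0 K_closed K_convex K_cone T_pd VK).
have xle k : `|x k.+1 - xbar| <= opnorm (T^-1)%VF * `|x k - xbar|.
  have [V stepV] := xN k.
  exact: newton_step_le xbarE stepV.
split=> //; apply: geometric_Q_linear_cvg xle.
by rewrite opnorm_ge0.
Qed.
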